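(* Let $F(z)=U(x,y)+\mathrm{i}V(x,y)$, $z=x+\mathrm{i}y$, be holomorphic in a neighborhood of the real axis and real-valued on the real axis. Then $V(x,0)=0$ for all $x\in\mathbb{R}$. Moreover, if the complementary Cauchy datum is denoted by $g(x)=\partial_yV(x,0)$, then for every $x\in\mathbb{R}$ $$\partial_xF(x)=\lim_{h\to0^+}\frac{\operatorname{Im}\left[F(x+\mathrm{i}h)\right]}{h}=g(x).$$
   Context: $U$ and $V$ are the real and imaginary parts of $F$ and $\mathrm{i}$ is the imaginary unit. $\partial_xF(x)$ is the derivative of $F$ with respect to the real variable at the real point $x$. *)

(* Defs.v *)
From Stdlib Require Export Reals.
From Coquelicot Require Export Coquelicot.

Open Scope R_scope.

Definition Vpart (F : C -> C) (x y : R) : R := Im (F (RtoC x + Ci * RtoC y)%C).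

(** [ex_derive] is used over the scalar ring [C], so that differentiability is
    complex differentiability. *)
Definition holomorphic_on (D : C -> Prop) (F : C -> C) : Prop :=
  open (T := C_UniformSpace) D /\
  forall z : C, D z -> ex_derive (K := C_AbsRing) (V := C_NormedModule) F z.

(** [F] is a total function on [C]; its values away from some open set
    containing the real axis are unconstrained. *)
Definition holomorphic_near_real_axis (F : C -> C) : Prop :=
  exists D : C -> Prop,
    (forall x : R, D (RtoC x)) /\ holomorphic_on D F.

Definition real_valued_on_real_axis (F : C -> C) : Prop :=
  forall x : R, exists r : R, F (RtoC x) = RtoC r.

(** Derivative in the real variable [x]: [C] is a normed module over [R] here. *)
Definition is_partial_x (F : C -> C) (x : R) (l : C) : Prop :=
  is_derive (K := R_AbsRing) (V := C_R_NormedModule)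
    (fun t : R => F (RtoC t)) x l.

(* Main.v *)
From Stdlib Require Import Lra.
Require Import Defs.

(** A complex derivative [l] of [F] at a point gives every directional
    derivative there: [v * l] in direction [v].  Direction [1] yields
    [Im l = 0], since [Im F] vanishes on the real axis; direction [Ci] then
    yields the derivative [Im (Ci * l) = Re l = l] of [V] in [y]. *)

(** Over the scalars [R] the norm of [C] is the product norm, whose square root has absolute values
    inside; squaring removes them. *)
Lemma norm_C_R (z : C) : norm (V := C_R_NormedModule) z = Cmod z.
Proof.
change (sqrt (Rabs (fst z) ^ 2 + Rabs (snd z) ^ 2)
        = sqrt (fst z ^ 2 + snd z ^ 2)).
now rewrite !pow2_abs.
Qed.

Lemma Cmod_line_sub (p v : C) (t s : R) :
  Cmod ((p + v * RtoC t) - (p + v * RtoC s))%C = Cmod v * Rabs (t - s).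
Proof.
rewrite <- Cmod_R, <- Cmod_mult, RtoC_minus.
f_equal; ring.
Qed.

(** The complex little-o estimate is restricted to the line, where an increment [t - t0] of the
    parameter moves the point by a distance [Cmod v * Rabs (t - t0)]. *)
Lemma is_derive_C_line (F : C -> C) (p v l : C) (t0 : R) :
  is_derive (K := C_AbsRing) (V := C_NormedModule) F (p + v * RtoC t0)%C l ->
  is_derive (K := R_AbsRing) (V := C_R_NormedModule)
    (fun t : R => F (p + v * RtoC t)%C) t0 (v * l)%C.
Proof.
intros [_ HF].
split; [apply is_linear_scal_l|].
intros x Hx.
apply (is_filter_lim_locally_unique t0 x) in Hx; subst x.
intros eps.
assert (Hv : 0 <= Cmod v) by apply Cmod_ge_0.
(* Both the tolerance and the radius are divided by [Cmod v + 1] rather than [Cmod v], so that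
   [v = 0] needs no separate case. *)
assert (Hv1 : 0 < Cmod v + 1) by lra.
assert (Hscale : forall e r : R, 0 <= e -> 0 <= r ->
          e / (Cmod v + 1) * (Cmod v * r) <= e * r).
{ intros e r He Hr.
  replace (e * r) with (e / (Cmod v + 1) * ((Cmod v + 1) * r)) by (field; lra).
  apply Rmult_le_compat_l; [apply Rdiv_le_0_compat; lra|].
  apply Rmult_le_compat_r; lra. }
assert (Heps : 0 < eps / (Cmod v + 1))
  by (apply Rdiv_lt_0_compat; [apply cond_pos|lra]).
destruct (HF _ (fun P HP => HP) (mkposreal _ Heps)) as [d Hd].
assert (Hd1 : 0 < d / (Cmod v + 1))
  by (apply Rdiv_lt_0_compat; [apply cond_pos|lra]).
exists (mkposreal _ Hd1); intros t Ht.
change (Rabs (t - t0) < d / (Cmod v + 1)) in Ht.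
assert (Hball : Cmod ((p + v * RtoC t) - (p + v * RtoC t0))%C < d).
{ rewrite Cmod_line_sub.
  apply Rle_lt_trans with ((Cmod v + 1) * Rabs (t - t0)).
  - apply Rmult_le_compat_r; [apply Rabs_pos|lra].
  - apply Rlt_le_trans with ((Cmod v + 1) * (d / (Cmod v + 1))).
    + now apply Rmult_lt_compat_l.
    + right; field; lra. }
specialize (Hd _ Hball).
change (Cmod (F (p + v * RtoC t) - F (p + v * RtoC t0)
              - ((p + v * RtoC t) - (p + v * RtoC t0)) * l)%C
        <= eps / (Cmod v + 1)
           * Cmod ((p + v * RtoC t) - (p + v * RtoC t0))%C) in Hd.
rewrite Cmod_line_sub in Hd.
rewrite norm_C_R.
change (norm (minus t t0)) with (Rabs (t - t0)).
apply Rle_trans with (2 := Hscale eps _ (Rlt_le _ _ (cond_pos eps))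
                              (Rabs_pos (t - t0))).
eapply Rle_trans with (2 := Hd); right; f_equal.
(* The two remainders are the same complex number: the real multiple [t - t0] of [v * l] is the
   complex increment times [l]. *)
apply injective_projections; cbn; ring.
Qed.

(** Chain rule with the real-linear map [snd], which is its own differential. *)
Lemma is_derive_Im (f : R -> C) (x : R) (l : C) :
  is_derive (K := R_AbsRing) (V := C_R_NormedModule) f x l ->
  is_derive (fun t : R => Im (f t)) x (Im l).
Proof.
intros Hf.
exact (filterdiff_comp' (K := R_AbsRing) (V := C_R_NormedModule) f
         (fun z : R * R => snd z) x _ _ Hf
         (filterdiff_linear _ is_linear_snd)).
Qed.

(** As [f 0 = 0], [f h / h] is the difference quotient at 0; the two-sided limit is then restricted
    to [h > 0]. *)
Lemma is_derive_0_quotient (f : R -> R) (l : R) :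
  f 0 = 0 -> is_derive f 0 l ->
  filterlim (fun h : R => f h / h) (at_right 0) (locally l).
Proof.
intros f0 Hf.
apply is_derive_Reals in Hf.
apply filterlim_locally; intros eps.
destruct (Hf eps (cond_pos eps)) as [d Hd].
exists d; intros h Hh Hpos.
change (Rabs (h - 0) < d) in Hh; rewrite Rminus_0_r in Hh.
specialize (Hd h (Rgt_not_eq _ _ Hpos) Hh).
now rewrite Rplus_0_l, f0, Rminus_0_r in Hd.
Qed.

Theorem theorem4p4 (F : C -> C)
    (hol : holomorphic_near_real_axis F)
    (real : real_valued_on_real_axis F) :
  (forall x : R, Vpart F x 0 = 0) /\
  (forall x : R, ex_derive (fun y : R => Vpart F x y) 0) /\
  (forall g : R -> R,
     (forall x : R, g x = Derive (fun y : R => Vpart F x y) 0) ->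
     forall x : R,
       is_partial_x F x (RtoC (g x)) /\
       filterlim (fun h : R => Im (F (RtoC x + Ci * RtoC h)%C) / h)
         (at_right 0) (locally (g x))).
Proof.
assert (HV0 : forall x : R, Vpart F x 0 = 0).
{ intros x; unfold Vpart.
  rewrite Cmult_0_r, Cplus_0_r.
  now destruct (real x) as [r ->]. }
(* A single real [a] serves as both derivatives. Its existence also ensures that [Derive] in the
   hypothesis on [g] is a true derivative and not a default value. *)
assert (key : forall x : R, exists a : R,
          is_partial_x F x (RtoC a)
          /\ is_derive (fun y : R => Vpart F x y) 0 a).
{ intros x.
  destruct hol as [D [HD [_ Hdiff]]].
  destruct (Hdiff _ (HD x)) as [l Hl].
  assert (Hx : is_partial_x F x l).
  (* The real axis is the line through 0 with direction 1. *)
  { replace l with (1 * l)%C by ring.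
    apply is_derive_ext with (f := fun t : R => F (0 + 1 * RtoC t)%C).
    - intros t; f_equal; ring.
    - apply is_derive_C_line.
      now replace (0 + 1 * RtoC x)%C with (RtoC x) by ring. }
  assert (HIm : Im l = 0).
  (* [Im l] is the derivative of [Im (F t)] along the real axis, a function that is identically
     0. *)
  { rewrite <- (is_derive_unique _ _ _ (is_derive_Im _ _ _ Hx)).
    rewrite <- (Derive_const 0 x) at 1.
    apply Derive_ext; intros t.
    now destruct (real t) as [r ->]. }
  exists (Re l); split.
  - replace (RtoC (Re l)) with l; [exact Hx|].
    now apply injective_projections.
  - replace (Re l) with (Im (Ci * l)%C) by (unfold Im, Re; cbn; ring).
    (* Here the line is the vertical one through [x], with direction [Ci] and parameter 0. *)
    apply is_derive_Im, is_derive_C_line.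
    now rewrite Cmult_0_r, Cplus_0_r. }
split; [exact HV0|split].
- intros x; destruct (key x) as [a [_ Ha]]; now exists a.
- intros g Hg x; destruct (key x) as [a [Hx Ha]].
  rewrite Hg, (is_derive_unique _ _ _ Ha).
  split; [exact Hx|].
  exact (is_derive_0_quotient _ _ (HV0 x) Ha).
Qed.
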